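(* Let $p\geq 2$ be a fixed integer. The average value of the first part of a composition in $\mathrm{MI}_n^p$ satisfies, as $n\to\infty$, $$\frac{1}{|\mathrm{MI}_n^p|}\sum_{x\in \mathrm{MI}_n^p}\mathtt{first}(x)=p\left(1-\frac{p}{n}+\frac{p(p+1)}{3n^2}+O\left(\frac{1}{n^3}\right)\right),$$ where $\mathtt{first}(x)=x_1$ for $x=(x_1,\ldots,x_m)$.
   Context: A composition of $n\ge 1$ is a tuple $(x_1,\ldots,x_m)$ of positive integers with $m\geq 1$ and $x_1+\cdots+x_m=n$. $\mathbb{F}_n^p$ is the set of compositions of $n$ all of whose parts satisfy $1\leq x_i\leq p$. It is ordered by the dominance order: $(x_1,\ldots,x_m)\leq (y_1,\ldots,y_\ell)$ iff $\sum_{i=1}^k x_i\leq\sum_{i=1}^k y_i$ for all $1\leq k\leq\min(m,\ell)$. With this order $\mathbb{F}_n^p$ is a finite distributive lattice. An element $y$ is an upper cover of $x$ if $x<y$ and $x\le z\le y$ implies $z\in\{x,y\}$. $\mathrm{MI}_n^p$ is the set of meet-irreducible elements of $\mathbb{F}_n^p$, i.e. the elements having exactly one upper cover in $\mathbb{F}_n^p$. The constant implied by $O(\cdot)$ may depend on $p$. *)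

(* Defs.v *)
From HB Require Import structures.
From mathcomp Require Import all_boot all_order all_algebra.
From mathcomp Require Import all_classical all_reals all_analysis.

Set Implicit Arguments.
Unset Strict Implicit.
Unset Printing Implicit Defensive.

Import Order.TTheory.

Definition is_composition (n : nat) (s : seq nat) : bool :=
  [&& s != [::], all (leq 1) s & sumn s == n].

(* The type of compositions of n with all parts at most p. *)
Record fcomp (n p : nat) := FComp {
  parts :> seq nat;
  _ : is_composition n parts && all (geq p) parts
}.

HB.instance Definition _ n p := [isSub for @parts n p].
HB.instance Definition _ n p := [Countable of fcomp n p by <:].

Lemma fcompP n p (x : fcomp n p) :
  [/\ 0 < size x, all (leq 1) x, all (geq p) x & sumn x = n].
Proof.
case: x => s /= /andP[/and3P[s0 s1 /eqP sn] sp]; split=> //.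
by rewrite lt0n size_eq0.
Qed.

Lemma leq_size_sumn (s : seq nat) : all (leq 1) s -> size s <= sumn s.
Proof.
elim: s => //= a s IH /andP[a1 /IH sP].
by rewrite -add1n leq_add.
Qed.

Lemma fcomp_size n p (x : fcomp n p) : size x <= n.
Proof. by have [_ /leq_size_sumn h _ xn] := fcompP x; rewrite xn in h. Qed.

(* A composition of n has at most n parts, which makes fcomp n p finite. *)
Definition fcomp_code n p (x : fcomp n p) : {bseq n of 'I_p.+1} :=
  insub_bseq n (map (@inord p) x).

Definition fcomp_decode n p (b : {bseq n of 'I_p.+1}) : option (fcomp n p) :=
  insub (map val b).

Lemma fcomp_codeK n p : pcancel (@fcomp_code n p) (@fcomp_decode n p).
Proof.
move=> x; rewrite /fcomp_decode /fcomp_code /insub_bseq insubdK; last first.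
  by rewrite -topredE /= size_map fcomp_size.
rewrite -map_comp (_ : map _ _ = val x); first exact: eqtype.valK.
have [_ _ xp _] := fcompP x.
rewrite -[RHS]map_id; apply/eq_in_map => i ix /=.
by rewrite inordK // ltnS; move/allP: xp; apply.
Qed.

HB.instance Definition _ n p :=
  fintype.isFinite.Build (fcomp n p) (pcan_enumP (@fcomp_codeK n p)).

Definition psum (k : nat) (s : seq nat) : nat := sumn (take k s).

Definition dominance (s t : seq nat) : bool :=
  all (fun k => psum k s <= psum k t) (iota 1 (minn (size s) (size t))).

Lemma dominanceP (s t : seq nat) :
  reflect (forall k, 1 <= k <= minn (size s) (size t) -> psum k s <= psum k t)
          (dominance s t).
Proof.
apply: (iffP allP) => h k; first by move=> hk; apply: h; rewrite mem_iota.
by rewrite mem_iota add1n ltnS; apply: h.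
Qed.

Lemma psum_lt n p (x : fcomp n p) k : k < size x -> psum k x < n.
Proof.
move=> kx; have [_ x1 _ xn] := fcompP x.
rewrite -[X in _ < X]xn -[X in sumn X](cat_take_drop k) sumn_cat.
rewrite -addn1 leq_add2l; apply: leq_trans (leq_size_sumn _).
  by rewrite size_drop subn_gt0.
by apply/allP => i /mem_drop; move/allP: x1; apply.
Qed.

Lemma psum_size n p (x : fcomp n p) : psum (size x) x = n.
Proof. by rewrite /psum take_size; have [] := fcompP x. Qed.

Definition fdom n p (x y : fcomp n p) : bool := dominance x y.

Lemma fdom_refl n p : reflexive (@fdom n p).
Proof. by move=> x; apply/dominanceP. Qed.

Lemma psum_inj (s t : seq nat) : size s = size t ->
  (forall k, k <= size s -> psum k s = psum k t) -> s = t.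
Proof.
elim: s t => [|a s IH] [|b t] //= [st] h.
have := h 1 isT; rewrite /psum /= !take0 /= !addn0 => ab.
rewrite -ab; congr cons; apply: IH => // k ks.
by have := h k.+1 ks; rewrite /psum /= -ab => /addnI.
Qed.

Lemma fdom_anti n p : antisymmetric (@fdom n p).
Proof.
move=> x y /andP[/dominanceP xy /dominanceP yx].
have xyE k : k <= minn (size x) (size y) -> psum k x = psum k y.
  case: k => [|k] hk; first by rewrite /psum !take0.
  by apply/eqP; rewrite eqn_leq xy ?yx // minnC.
have sxy : size x = size y.
  apply/eqP; rewrite eqn_leq; apply/andP; split; rewrite leqNgt; apply/negP => h.
    by have := psum_lt h; rewrite xyE ?psum_size ?ltnn // leq_min leqnn ltnW.
  by have := psum_lt h; rewrite -xyE ?psum_size ?ltnn // leq_min leqnn ltnW.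
apply: val_inj; apply: psum_inj => // k kx; apply: xyE.
by rewrite leq_min kx -sxy.
Qed.

Lemma fdom_trans n p : transitive (@fdom n p).
Proof.
move=> y x z /dominanceP xy /dominanceP yz; apply/dominanceP => k.
rewrite leq_min => /and3P[k0 kx kz].
have [ky|yk] := leqP k (size y).
  by apply: leq_trans (xy k _) (yz k _); rewrite k0 leq_min ?kx ?ky ?kz.
have [y0 _ _ _] := fcompP y.
have yz' := leq_trans yk kz.
have := leq_trans (yz (size y) _) (ltnW (psum_lt yz')).
have := psum_lt yz'; rewrite ltnNge; case/negP.
by rewrite -{1}(psum_size y); apply: yz; rewrite y0 leq_min leqnn ltnW.
Qed.

Fact fcomp_display : Order.disp_t. Proof. exact: Order.Disp tt tt. Qed.

HB.instance Definition _ n p := Order.Le_isPOrder.Build fcomp_display (fcomp n p)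
  (@fdom_refl n p) (@fdom_anti n p) (@fdom_trans n p).

Definition upper_cover d (T : finPOrderType d) (x y : T) : bool :=
  (x < y)%O && [forall z : T, (x <= z <= y)%O ==> (z \in [:: x; y])].

(* Meet-irreducible elements: exactly one upper cover. *)
Definition MI n p : {set fcomp n p} :=
  [set x | #|[set y | upper_cover x y]| == 1].

Definition first_part (s : seq nat) : nat := head 0 s.

Local Open Scope ring_scope.

(* MI n p is empty for n = 1; the value is then 0. *)
Definition average_first (R : realType) (n p : nat) : R :=
  (\sum_(x in MI n p) (first_part x)%:R) / #|MI n p|%:R.

(* Main.v *)
Require Import Defs.
From mathcomp Require Import all_boot all_order all_algebra.
From mathcomp Require Import all_classical all_reals all_analysis.
From mathcomp Require Import zify ring lra.
Import Order.TTheory GRing.Theory Num.Theory numFieldNormedType.Exports.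
Local Open Scope classical_set_scope.
Local Open Scope ring_scope.

(* An upper cover of [x] increases exactly one partial sum by 1, which is
   possible at part [x_i] iff [x_i < p] and [x_{i+1}] is either at least 2 or the
   last part. Hence the meet-irreducibles are the words [p^a c 1^b p^e f] with
   [1 <= c < p] and [1 <= f <= p]. Such a word is determined by
   [j = p a + c], not divisible by [p], and [q = p e + f >= 1], subject only to
   [j + q <= n]; so [|MI| = C], where [C] is the sum of [n - j] over [j <= n] not
   divisible by [p], and [2 p C = (p - 1) n^2 - r (p - r)] with [r = n mod p].
   The first part is [p] unless [j = c < p], so the sum of the first parts is
   [p C] minus the sum of [(p - c) (n - c)] over [1 <= c < p]. *)

(** * Partial sums and upper covers *)

Section Covers.
Set Implicit Arguments.
Unset Strict Implicit.
Local Open Scope nat_scope.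

Lemma psumS k s : psum k.+1 s = psum k s + nth 0 s k.
Proof.
rewrite /psum; have [h|h] := ltnP k (size s).
  by rewrite (take_nth 0) // sumn_rcons.
by rewrite !take_oversize ?nth_default ?addn0 // ltnW.
Qed.

(* Indices are 0-based: [good p s i] is the condition at the [i]-th part, and
   [raise i s] increases the partial sum of the first [i.+1] parts. *)
Fixpoint good (p : nat) (s : seq nat) (i : nat) : bool :=
  if s is a :: s' then
    if i is i'.+1 then good p s' i' else
    if s' is b :: t then (a < p) && ((1 < b) || nilp t) else false
  else false.

Lemma goodE p s i : good p s i =
  [&& i.+1 < size s, nth 0 s i < p & (1 < nth 0 s i.+1) || (i.+2 == size s)].
Proof.
elim: s i => [|a s IH] [|i] //=.
by case: s {IH} => [|b [|c t]].
Qed.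

Fixpoint raise (i : nat) (s : seq nat) : seq nat :=
  if s is a :: s' then
    if i is i'.+1 then a :: raise i' s' else
    a.+1 :: (if s' is b :: t then if b is b'.+2 then b'.+1 :: t else t else s')
  else s.

Lemma raise_parts p s i : good p s i -> all (leq 1) s -> all (geq p) s ->
  all (leq 1) (raise i s) && all (geq p) (raise i s).
Proof.
elim: s i => [|a s IH] [|i] //=.
  case: s {IH} => [|[|[|b]] t] //= /andP[-> /=]; case: t => //= *; lia.
move=> gi /andP[a0 s0] /andP[ap sp]; rewrite a0 ap /=; exact: IH.
Qed.

(** When part [i.+1] is 1, [raise] deletes it; [good] then makes it the last part, so the partial
    sums beyond it are the unchanged total. *)
Lemma psum_raise p s i k : good p s i -> all (leq 1) s ->
  psum k (raise i s) = psum k s + (k == i.+1).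
Proof.
have psumC a t l : psum l.+1 (a :: t) = a + psum l t by [].
have psumn0 t : psum 0 t = 0 by rewrite /psum take0.
elim: s i k => [|a s IH] [|i] [|k] //=; last first.
  by move=> gi /andP[a0 s0]; rewrite !psumC IH // eqSS addnA.
case: s {IH} => [|[|[|b]] [|c t]] //=; rewrite ?andbF //; case: k => [|k] *;
  rewrite !psumC ?psumn0 ?psumC /psum /= ?eqSS; lia.
Qed.

Lemma raise_neq0 s i : s != [::] -> raise i s != [::].
Proof. by case: s i => [|a s] [|i]. Qed.

Lemma psum_oversize n p (x : fcomp n p) k : size x <= k -> psum k x = n.
Proof. by move=> h; rewrite /psum take_oversize //; have [] := fcompP x. Qed.

Lemma psum_le n p (x : fcomp n p) k : psum k x <= n.
Proof.
by have [/psum_oversize->//|/psum_lt/ltnW] := leqP (size x) k.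
Qed.

(** The cut-off at the shorter length is harmless: past its end a composition has partial sum [n],
    and [y] cannot be longer than [x] when [x <= y]. *)
Lemma fcomp_leP n p (x y : fcomp n p) :
  reflect (forall k, psum k x <= psum k y) (x <= y)%O.
Proof.
apply: (iffP (dominanceP x y)) => h k; last by move=> _.
have [ky|ky] := leqP (size y) k; first by rewrite (psum_oversize ky) psum_le.
case: k ky => [|k] ky; first by rewrite /psum !take0.
have [kx|kx] := leqP k.+1 (size x).
  by apply: h; rewrite leq_min kx (ltnW ky).
have [x0 _ _ _] := fcompP x; have xy := leq_trans kx (ltnW ky).
have := h (size x); rewrite x0 leq_min leqnn (ltnW xy) => /(_ isT).
by rewrite psum_size leqNgt psum_lt.
Qed.

Lemma fcomp_psum_inj n p (x y : fcomp n p) :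
  (forall k, psum k x = psum k y) -> x = y.
Proof.
by move=> h; apply: le_anti; apply/andP; split; apply/fcomp_leP => k; rewrite h.
Qed.

Lemma raise_fcomp_subproof n p (x : fcomp n p) i : good p x i ->
  is_composition n (raise i x) && all (geq p) (raise i x).
Proof.
move=> gi; have [x0 x1 xp xn] := fcompP x.
have /andP[r1 rp] := raise_parts gi x1 xp.
rewrite /is_composition r1 rp raise_neq0 -?size_eq0 -?lt0n //= andbT.
(* Any index beyond both lengths and different from [i.+1] compares the total sums. *)
pose k := (size (raise i x) + size x + i.+2).
have := psum_raise k gi x1.
rewrite {1 2}/psum !take_oversize /k ?xn; try lia.
Qed.

Lemma ex_raise n p (x : fcomp n p) i : good p x i ->
  exists y : fcomp n p, forall k, psum k y = psum k x + (k == i.+1).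
Proof.
move=> gi; exists (FComp (raise_fcomp_subproof gi)) => k /=.
by apply: (psum_raise _ gi); have [] := fcompP x.
Qed.

(* Take the last index [i] with [x_i < p] at which the partial sums of [y]
   exceed those of [x]: a part 1 following it would give a later such index. *)
Lemma ex_good n p (x y : fcomp n p) : 1 < p -> (x < y)%O ->
  exists2 i, good p x i & psum i.+1 x < psum i.+1 y.
Proof.
move=> p1; rewrite lt_neqAle => /andP[xNy /fcomp_leP xy].
have [x0 x1 xp xn] := fcompP x; have [y0 y1 yp yn] := fcompP y.
have exD : exists k, psum k x < psum k y.
  apply: contrapT => /forallNP h; move/eqP: xNy; apply.
  by apply: fcomp_psum_inj => k; have := h k; have := xy k; lia.
pose E i := (psum i.+1 x < psum i.+1 y) && (nth 0 x i < p).
(* At the first strict excess the part of [x] is smaller than that of [y], hence below [p]. *)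
have exE : exists i, E i.
  have := ex_minnP exD; case=> -[|i] lti mini.
    by rewrite /psum !take0 in lti.
  exists i; rewrite /E lti /=.
  have : ~~ (psum i x < psum i y) by apply/negP => /mini; rewrite ltnn.
  have : nth 0 y i <= p.
    have [iy|iy] := ltnP i (size y); last by rewrite nth_default.
    by move/allP: yp; apply; apply: mem_nth.
  by move: lti; rewrite !psumS; have := xy i; lia.
have Elt i : E i -> i.+1 < size x.
  case/andP=> lti _; rewrite ltnNge; apply/negP => /psum_oversize e.
  by have := psum_le y i.+1; rewrite e in lti; lia.
have bE i : E i -> i <= size x by move=> /Elt; lia.
have [i Ei maxi] := ex_maxnP exE bE.
have ltx := Elt i Ei; have /andP[lti xip] := Ei.
exists i => //; rewrite goodE ltx xip /=; apply/norP => -[x2 isx].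
have xi1 : nth 0 x i.+1 = 1.
  have : 1 <= nth 0 x i.+1 by move/allP: x1; apply; apply: mem_nth.
  lia.
have ltx2 : i.+2 < size x by lia.
suff /maxi : E i.+1 by rewrite ltnn.
rewrite /E xi1 p1 andbT.
have [iy|iy] := leqP (size y) i.+2.
  by rewrite (psum_oversize iy) psum_lt.
have : 1 <= nth 0 y i.+1 by move/allP: y1; apply; apply: mem_nth; exact: ltnW.
by rewrite psumS xi1 (psumS i.+1 y); lia.
Qed.

Definition ngood p s := count (good p s) (iota 0 (size s)).

Lemma ngood_cons p a s : ngood p (a :: s) = good p (a :: s) 0 + ngood p s.
Proof. by rewrite /ngood /= (iotaDl 1 0) count_map. Qed.

(** Below any [y > x] lies a raise of [x], which a cover must equal. Conversely, the partial sums of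
    an element between [x] and its raise are free at one index only, where two consecutive values
    are possible. *)
Lemma upper_coverP n p (x y : fcomp n p) : 1 < p ->
  reflect (exists2 i, good p x i & forall k, psum k y = psum k x + (k == i.+1))
          (upper_cover x y).
Proof.
move=> p1; apply: (iffP andP) => [[xy /forallP cov]|[i gi hy]].
  have [i gi lti] := ex_good p1 xy; exists i => //.
  have [z hz] := ex_raise gi; have := cov z; rewrite !inE.
  have -> /= : (x <= z <= y)%O.
    apply/andP; split; apply/fcomp_leP => k; rewrite hz ?leq_addr //.
    have := fcomp_leP x y (ltW xy) k.
    by have [->|_] := eqVneq k i.+1; rewrite ?addn0 // addn1.
  case/orP => /eqP e; last by rewrite -e.
  by have := hz i.+1; rewrite e eqxx; lia.
split.
  rewrite lt_neqAle; apply/andP; split; last first.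
    by apply/fcomp_leP => k; rewrite hy leq_addr.
  by apply/eqP => e; have := hy i.+1; rewrite e eqxx; lia.
apply/forallP => z; apply/implyP => /andP[/fcomp_leP xz /fcomp_leP zy].
rewrite !inE; have [e|ne] := eqVneq (psum i.+1 z) (psum i.+1 x).
  apply/orP; left; apply/eqP; apply: fcomp_psum_inj => k.
  have := xz k; have := zy k; rewrite hy.
  by have [->|_] := eqVneq k i.+1; [rewrite e|lia].
apply/orP; right; apply/eqP; apply: fcomp_psum_inj => k.
have := xz k; have := zy k; rewrite hy.
by have [->|_] := eqVneq k i.+1; lia.
Qed.

Lemma card_upper_cover n p (x : fcomp n p) : 1 < p ->
  #|[set y | upper_cover x y]%SET| = ngood p x.
Proof.
move=> p1; set U := finset _.
(* The indices where the partial sums differ: for a cover, just the raised one, so [head] recovers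
   it. *)
pose h (y : fcomp n p) : seq nat :=
  [seq i <- iota 0 (size x) | psum i.+1 y != psum i.+1 x].
have hU (y : fcomp n p) i : good p x i ->
  (forall k, psum k y = psum k x + (k == i.+1)) ->
  h y = [:: i].
  move=> gi hy; rewrite /h (eq_filter (a2 := pred1 i)) => [|k /=].
    have ix : i < size x by move: gi; rewrite goodE => /andP[/ltnW].
    by rewrite filter_pred1_uniq ?iota_uniq // mem_iota.
  by rewrite hy eqSS; case: (k == i); lia.
pose f (y : fcomp n p) := head 0 (h y).
rewrite cardE -(size_map f) /ngood -size_filter.
apply/perm_size/uniq_perm.
- rewrite map_inj_in_uniq ?enum_uniq // => y z.
  rewrite !mem_enum !inE => /(upper_coverP _ _ p1)[i gi hy].
  move=> /(upper_coverP _ _ p1)[j gj hz]; rewrite /f (hU y i) // (hU z j) //= => e.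
  by apply: fcomp_psum_inj => k; rewrite hy hz e.
- by rewrite filter_uniq ?iota_uniq.
move=> i; apply/mapP/idP => [[y]|].
  rewrite mem_enum inE => /(upper_coverP _ _ p1)[j gj hy] ->.
  rewrite /f (hU y j) //= mem_filter gj mem_iota.
  by move: gj; rewrite goodE => /andP[/ltnW].
rewrite mem_filter => /andP[gi _]; have [y hy] := ex_raise gi.
exists y; last by rewrite /f (hU y i).
by rewrite mem_enum inE; apply/(upper_coverP _ _ p1); exists i.
Qed.

End Covers.

(** * Meet-irreducibles as words, and their enumeration *)

Section Words.
Set Implicit Arguments.
Unset Strict Implicit.
Local Open Scope nat_scope.

Lemma ngood_cons2 p a b s : ngood p [:: a, b & s] =
  (a < p) && ((1 < b) || nilp s) + ngood p (b :: s).
Proof. by rewrite ngood_cons. Qed.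

Lemma ngood_tail p e f : ngood p (rcons (nseq e p) f) = 0.
Proof.
elim: e => [//|[|e] IH]; first by rewrite /= ngood_cons2 ltnn.
by rewrite /= ngood_cons2 ltnn.
Qed.

(** A first part below [p] that is not good precedes a non-final 1; as the tail is [p^e f], this
    would force [p = 1]. *)
Lemma ngood0 p s : s != [::] -> all (leq 1) s -> all (geq p) s ->
  ngood p s = 0 -> exists e f, s = rcons (nseq e p) f.
Proof.
elim: s => // a [|b s] IH _ /andP[a1 s1] /andP[ap sp].
  by exists 0, a.
rewrite ngood_cons2 => /eqP; rewrite addn_eq0 => /andP[ga /eqP/(IH isT s1 sp)].
case=> e [f ebs]; have [lt|] := ltnP a p; last first.
  by move=> pa; exists e.+1, f; rewrite ebs /=; congr cons; move: ap => /=; lia.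
move: ga; rewrite lt /=; case: (ltnP 1 b) => //= b1.
by case: e ebs => [|e] //= [? ?]; [subst|lia].
Qed.

Definition mi_word p a c b e f :=
  nseq a p ++ c :: nseq b 1 ++ rcons (nseq e p) f.

(** The one good part is the one just before [p^e f]; earlier parts equal [p] or precede a non-final
    1. *)
Lemma ngood_mi_word p a c b e f : 1 < p -> 0 < c < p -> 0 < f ->
  ngood p (mi_word p a c b e f) = 1.
Proof.
move=> p1 /andP[c0 cp] f0; rewrite /mi_word; elim: a => [|a IH] /=; last first.
  case: a IH => [|a] /= IH; first by rewrite ngood_cons2 ltnn IH.
  by rewrite ngood_cons2 ltnn IH.
elim: b c cp {c0} => [|b IH] c cp /=.
  case: e => [|e] /=; first by rewrite ngood_cons2 cp orbT.
  by have /= t0 := ngood_tail p e.+1 f; rewrite ngood_cons2 cp p1 t0.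
rewrite ngood_cons2 ltnn /= IH //.
have -> // : nilp (nseq b 1 ++ rcons (nseq e p) f) = false.
  by rewrite /nilp size_cat size_rcons addnS.
by rewrite andbF.
Qed.

(** If the first part is good, the rest is [p^e f]. Otherwise the rest is a word of this form: a
    first part [p] extends the block [p^a], and a smaller one becomes the new [c], the old [c = 1]
    joining the block of 1s. *)
Lemma ngood1 p s : 1 < p -> all (leq 1) s -> all (geq p) s -> ngood p s = 1 ->
  exists a c b e f, [/\ 0 < c < p, 0 < f <= p & s = mi_word p a c b e f].
Proof.
move=> p1; elim: s => // a [|b s] IH /andP[a1 s1] /andP[ap sp] //.
rewrite ngood_cons2; case: (boolP (_ && _)) => [/andP[lt _] | ga].
  rewrite add1n => -[] /(@ngood0 p (b :: s) isT s1 sp) [e [f ebs]].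
  exists 0, a, 0, e, f; rewrite ebs a1 lt; split=> //.
  have : f \in b :: s by rewrite ebs mem_rcons mem_head.
  have /allP s1' : all (leq 1) (b :: s) := s1.
  have /allP sp' : all (geq p) (b :: s) := sp.
  by move=> fi; rewrite s1' //; exact: sp'.
rewrite add0n => /(IH s1 sp) [a' [c [b' [e [f [c0 f0 ebs]]]]]].
move: ga; have [lt|pa _] := ltnP a p; last first.
  exists a'.+1, c, b', e, f; split=> //; rewrite ebs /mi_word /=; congr cons.
  by move: ap => /=; lia.
rewrite /= negb_or -leqNgt => /andP[b1 s0].
case: a' ebs => [|a']; rewrite /mi_word /= => -[eb es]; last lia.
exists 0, a, b'.+1, e, f; split=> //; first by rewrite a1.
by rewrite /mi_word es /=; congr [:: _, _ & _]; move: s1 => /= /andP[]; lia.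
Qed.

Lemma mi_word_parts p a c b e f : 1 < p -> 0 < c < p -> 0 < f <= p ->
  all (leq 1) (mi_word p a c b e f) && all (geq p) (mi_word p a c b e f).
Proof.
move=> p1 /andP[c0 cp] /andP[f0 fp].
rewrite !(all_cat, all_rcons, all_nseq) /= !(all_cat, all_rcons, all_nseq) /=.
lia.
Qed.

Lemma sumn_mi_word p a c b e f :
  sumn (mi_word p a c b e f) = p * a + c + (b + (p * e + f)).
Proof. by rewrite /mi_word sumn_cat /= sumn_cat sumn_rcons !sumn_nseq; lia. Qed.

(* [decode] reads off [p a + c] and [p e + f]. The [maxn] handles [e = 0, f = 1],
   where the last part is not distinguished from the preceding parts 1. *)
Definition decode p (s : seq nat) : nat * nat :=
  let i := (find (predC1 p) s).+1 in
  let t := drop i s in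
  (psum i s, maxn 1 (sumn (drop (find (predC1 1) t) t))).

Lemma decode_mi_word p a c b e f : 1 < p -> 0 < c < p -> 0 < f <= p ->
  decode p (mi_word p a c b e f) = (p * a + c, p * e + f).
Proof.
move=> p1 /andP[c0 cp] /andP[f0 fp].
have fi : find (predC1 p) (mi_word p a c b e f) = a.
  rewrite /mi_word find_cat has_nseq /= eqxx andbF size_nseq.
  by rewrite (_ : (c != p) = true) ?addn0; lia.
rewrite /decode fi; congr pair.
  by rewrite /psum /mi_word take_cat size_nseq ltnNge leqnSn /= subSnn /= take0
     sumn_cat sumn_nseq /= addn0.
rewrite /mi_word drop_cat size_nseq ltnNge leqnSn /= subSnn /= drop0.
rewrite find_cat has_nseq /= andbF size_nseq.
rewrite drop_cat size_nseq ltnNge leq_addr /= addKn.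
case: e {fi} => [|e] /=.
  by have [->|f1] /= := eqVneq f 1; rewrite ?drop0 /= ?addn0 ?muln0; lia.
have -> /= : p != 1 by lia.
by rewrite sumn_rcons sumn_nseq; nia.
Qed.

Lemma mi_wordP n p (x : fcomp n p) : 1 < p ->
  reflect (exists a c b e f,
             [/\ 0 < c < p, 0 < f <= p & parts x = mi_word p a c b e f])
          (x \in MI n p).
Proof.
move=> p1; rewrite inE card_upper_cover //; apply: (iffP eqP).
  by have [_ x1 xp _] := fcompP x; apply: ngood1.
case=> a [c [b [e [f [c0 /andP[f0 _] ->]]]]]; exact: ngood_mi_word.
Qed.

(** [decode] is a bijection onto the pairs [(j, q)] with [p] not dividing [j], [q >= 1] and
    [j + q <= n]. Each [j] admits [n - j] values of [q], and the first part is [minn j p]. *)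
Lemma sum_MI n p (F : nat -> nat) : 1 < p ->
  \sum_(x in MI n p) F (first_part x) =
  \sum_(1 <= j < n.+1 | ~~ (p %| j)) F (minn j p) * (n - j).
Proof.
move=> p1.
pose h (x : fcomp n p) : 'I_n.+1 * 'I_n.+1 :=
  (inord (decode p x).1, inord (decode p x).2).
have hE (x : fcomp n p) : x \in MI n p -> exists a c b e f,
    [/\ 0 < c < p, 0 < f <= p & parts x = mi_word p a c b e f] /\
    [/\ (h x).1 = p * a + c :> nat, (h x).2 = p * e + f :> nat &
     n = p * a + c + (b + (p * e + f))].
  case/mi_wordP=> // a [c [b [e [f [c0 f0 ex]]]]].
  have [_ _ _ xn] := fcompP x; rewrite ex sumn_mi_word in xn.
  exists a, c, b, e, f; split=> //.
  have hx : decode p x = (p * a + c, p * e + f) by rewrite ex decode_mi_word.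
  by split=> //; rewrite /h hx /= inordK //; lia.
(* Uniqueness of division by [p] with remainders in [1..p]. *)
have uni a c a' c' : 0 < c <= p -> 0 < c' <= p -> p * a + c = p * a' + c' ->
    a = a' /\ c = c'.
  move=> hc hc' e; suff aa : a = a' by rewrite aa in e; lia.
  by apply/eqP; rewrite eqn_leq; apply/andP; split;
    rewrite leqNgt; apply/negP => ?; nia.
have hinj : {in MI n p &, injective h}.
  move=> x y /hE[a [c [b [e [f [[c0 f0 ex] [h1 h2 en]]]]]]].
  move=> /hE[a' [c' [b' [e' [f' [[c0' f0' ey] [h1' h2' en']]]]]]] hxy.
  rewrite hxy h1' in h1; rewrite hxy h2' in h2.
  have [aa cc] : a' = a /\ c' = c by apply: uni h1; lia.
  have [ee ff] : e' = e /\ f' = f by apply: uni h2; lia.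
  apply: val_inj; rewrite /= ex ey; subst.
  by congr mi_word; lia.
pose D := [set d : 'I_n.+1 * 'I_n.+1 |
   [&& 0 < d.1, ~~ (p %| d.1), 0 < d.2 & d.1 + d.2 <= n]]%SET.
have imh : [set h x | x in MI n p]%SET = D.
  apply/setP => -[j q]; apply/imsetP/idP => [[x xM ->]|].
    rewrite inE; have [a [c [b [e [f [[c0 f0 ex] [-> -> en]]]]]]] := hE x xM.
    rewrite dvdn_addr ?dvdn_mulr // gtnNdvd //; lia.
  rewrite inE /= => /and4P[j0 pj q0 jq].
  (* Dividing [q.-1] instead of [q] puts [f] in [1..p]; [c] is nonzero because [p] does not divide
     [j]. *)
  pose a := j %/ p; pose c := j %% p;
  pose e := q.-1 %/ p; pose f := (q.-1 %% p).+1.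
  pose b := n - j - q.
  have ej : j = p * a + c :> nat by rewrite mulnC -divn_eq.
  have eq : q = p * e + f :> nat.
    by rewrite /f addnS mulnC -divn_eq prednK.
  have c0 : 0 < c < p by rewrite lt0n ltn_mod (ltnW p1) andbT.
  have f0 : 0 < f <= p by rewrite /f /= ltn_mod (ltnW p1).
  have wP : is_composition n (mi_word p a c b e f) &&
             all (geq p) (mi_word p a c b e f).
    have /andP[w1 wp] := mi_word_parts a b e p1 c0 f0.
    rewrite /is_composition w1 wp sumn_mi_word -ej -eq.
    by rewrite (_ : mi_word _ _ _ _ _ _ != [::]) /=; [lia|case: (a)].
  exists (FComp wP); first by apply/mi_wordP => //; exists a, c, b, e, f.
  rewrite /h; have -> : decode p (FComp wP) = (nat_of_ord j, nat_of_ord q).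
    by rewrite ej eq; exact: decode_mi_word.
  by rewrite /= !inord_val.
have -> : \sum_(x in MI n p) F (first_part x) =
          \sum_(x in MI n p) F (minn (h x).1 p).
  apply: eq_bigr => x /hE[a [c [b [e [f [[c0 f0 ex] [-> _ _]]]]]]].
  rewrite /first_part ex; congr F; case: (a) => [|a'] /=; nia.
rewrite -(big_imset (fun d : 'I_n.+1 * 'I_n.+1 => F (minn d.1 p)) hinj) imh.
have -> : \sum_(1 <= j < n.+1 | ~~ (p %| j)) F (minn j p) * (n - j) =
          \sum_(j < n.+1 | (0 < j) && ~~ (p %| j)) F (minn j p) * (n - j).
  rewrite -(big_mkord (fun j => (0 < j) && ~~ (p %| j))
                      (fun j => F (minn j p) * (n - j))).
  rewrite [RHS]big_ltn_cond //= [LHS]big_nat_cond [RHS]big_nat_cond.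
  by apply: eq_bigl => j; lia.
rewrite (eq_bigl (fun d : 'I_n.+1 * 'I_n.+1 => ((0 < d.1) && ~~ (p %| d.1)) &&
                           ((0 < d.2) && (d.1 + d.2 <= n)))); last first.
  by move=> d; rewrite inE; lia.
rewrite -(pair_big_dep (fun j : 'I_n.+1 => (0 < j) && ~~ (p %| j))
  (fun j q : 'I_n.+1 => (0 < q) && (j + q <= n)) (fun j _ => F (minn j p))) /=.
apply: eq_bigr => j _; rewrite sum_nat_const mulnC; congr muln.
rewrite -sum1_card -(big_mkord (fun q => (0 < q) && (j + q <= n)) (fun=> 1)).
rewrite [LHS]big_ltn_cond //=.
transitivity (\sum_(1 <= q < (n - j).+1) 1).
  rewrite [RHS](big_nat_widen _ _ n.+1); last by lia.
  rewrite [LHS]big_nat_cond [RHS]big_nat_cond.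
  by apply: eq_bigl => q; lia.
by rewrite sum_nat_const_nat muln1 subn1.
Qed.

(** * Exact formulas for the count and the sum of first parts *)

Definition mi_count p n := \sum_(1 <= j < n.+1 | ~~ (p %| j)) (n - j).

Lemma card_MI n p : 1 < p -> #|MI n p| = mi_count p n.
Proof.
move=> p1; rewrite -sum1_card (sum_MI n (fun=> 1) p1).
by apply: eq_bigr => j _; rewrite mul1n.
Qed.

Lemma sum_first_MI n p : 1 < p -> p <= n.+1 ->
  \sum_(x in MI n p) first_part x + \sum_(1 <= c < p) (p - c) * (n - c) =
  p * mi_count p n.
Proof.
move=> p1 pn; rewrite (sum_MI n id p1) /mi_count.
rewrite !(big_cat_nat (ltnW p1) pn) /= mulnDr addnAC.
congr addn; rewrite big_distrr /=.
  rewrite [X in X + _]big_mkcond [RHS]big_mkcond -big_split /=.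
  apply: eq_big_nat => c /andP[c1 cp]; rewrite gtnNdvd //=; nia.
rewrite [LHS]big_nat_cond [RHS]big_nat_cond.
apply: eq_bigr => j /andP[/andP[pj _] _]; congr muln; lia.
Qed.

Lemma count_not_dvd p n : 0 < p ->
  (\sum_(1 <= j < n.+1 | ~~ (p %| j)) 1) + n %/ p = n.
Proof.
move=> p0; elim: n => [|n IH]; first by rewrite big_geq // div0n.
rewrite big_mkcond big_nat_recr //= -big_mkcond divnS //.
by case: (p %| n.+1) => /=; lia.
Qed.

(** Each of the [n - n %/ p] admissible [j <= n] gains 1, and [j = n.+1] contributes 0. *)
Lemma mi_countS p n : 0 < p -> mi_count p n.+1 + n %/ p = mi_count p n + n.
Proof.
move=> p0; rewrite /mi_count big_mkcond big_nat_recr //=.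
rewrite -big_mkcond subnn if_same addn0.
suff -> : \sum_(1 <= j < n.+1 | ~~ (p %| j)) (n.+1 - j) =
    \sum_(1 <= j < n.+1 | ~~ (p %| j)) (n - j) +
    \sum_(1 <= j < n.+1 | ~~ (p %| j)) 1.
  by rewrite -addnA count_not_dvd.
rewrite -big_split [LHS]big_nat_cond [RHS]big_nat_cond.
by apply: eq_bigr => j /=; lia.
Qed.

Lemma mi_countE p n : 0 < p ->
  2 * p * mi_count p n + (n %% p) * (p - n %% p) = (p - 1) * n ^ 2.
Proof.
move=> p0; elim: n => [|n IH].
  rewrite /mi_count big_geq // mod0n; lia.
have := mi_countS n p0; have := divn_eq n p; have := ltn_pmod n p0.
have : n.+1 %% p = if n %% p == p.-1 then 0 else (n %% p).+1.
  rewrite -addn1 -modnDml addn1; case: eqP => [->|ne].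
    by rewrite prednK // modnn.
  by rewrite modn_small //; have := ltn_pmod n p0; lia.
move=> ->; move: IH; move: (n %% p) (n %/ p) (mi_count p n) (mi_count p n.+1).
move=> r Q C C' IH rp en eC.
have h1 : 2 * p * C' + 2 * p * Q = 2 * p * C + 2 * p * n by rewrite -!mulnDr eC.
have h2 : 2 * p * Q + 2 * r = 2 * n by lia.
(* This removes the truncated subtractions; the remainder wraps to 0 exactly when [s = 0]. *)
have [s ep] : exists s, p = r + s.+1 by exists (p - r).-1; lia.
move: IH; rewrite -!mulnn ep addKn addnS subn1 /= -addnS.
case: eqP => [er|ne] IH.
  have s0 : s = 0 by lia.
  by subst s p; rewrite mul0n; move: IH h1 h2; clear; lia.
have -> : r + s.+1 - r.+1 = s by lia.
subst p; move: IH h1 h2; clear. nia.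
Qed.
End Words.

(** * Real estimates *)

Section Asymptotics.
Set Implicit Arguments.
Unset Strict Implicit.
Variable R : realType.

Lemma sum_mul_subr (a b : R) m :
  6 * (\sum_(1 <= c < m.+1) (a - c%:R) * (b - c%:R)) =
  6 * m%:R * a * b - 3 * (a + b) * m%:R * (m%:R + 1)
  + m%:R * (m%:R + 1) * (2 * m%:R + 1).
Proof.
elim: m => [|m IH]; first by rewrite big_geq // !mulr0 !mul0r; ring.
by rewrite big_nat_recr //= mulrDr IH -natr1; ring.
Qed.

Lemma mi_countE_R p n : (0 < p)%N ->
  exists2 rho : R, 0 <= rho <= p%:R ^+ 2 &
    2 * p%:R * (mi_count p n)%:R = (p%:R - 1) * n%:R ^+ 2 - rho.
Proof.
move=> p0; exists ((n %% p) * (p - n %% p))%:R.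
  rewrite ler0n -natrX ler_nat -mulnn leq_mul ?leq_subr //.
  by rewrite ltnW ?ltn_mod.
have -> : p%:R - 1 = (p - 1)%:R :> R by rewrite natrB.
by rewrite -natrX -!natrM -(mi_countE n p0) natrD addrK.
Qed.

Lemma sum_first_MI_R p n : (1 < p)%N -> (p <= n)%N ->
  6 * (p%:R * (mi_count p n)%:R - \sum_(x in MI n p) (first_part x)%:R) =
  p%:R * (p%:R - 1) * (3 * n%:R - (p%:R + 1)) :> R.
Proof.
move=> p1 pn; rewrite -natr_sum -natrM -(sum_first_MI p1 (leqW pn)) natrD.
rewrite addrAC subrr add0r natr_sum.
case: p p1 pn => // p _ pn.
have -> : \sum_(1 <= c < p.+1) ((p.+1 - c) * (n - c))%:R =
          \sum_(1 <= c < p.+1) (p.+1%:R - c%:R) * (n%:R - c%:R) :> R.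
  by apply: eq_big_nat => c /andP[_ cp]; rewrite natrM !natrB //; lia.
by rewrite sum_mul_subr -natr1; ring.
Qed.

(** The deficit of the sum of first parts is exactly linear in [n]. Were [rho] zero in the count,
    the three main terms would be exact, so only [rho <= p^2] causes an error. *)
Lemma average_first_bound p n : (1 < p)%N -> (2 * p <= n)%N ->
  `|average_first R n p / p%:R
    - (1 - p%:R / n%:R + p%:R * (p%:R + 1) / (3 * n%:R ^+ 2))|
  <= 2 * p%:R ^+ 3 * (n%:R ^+ 3)^-1.
Proof.
move=> p1 pn; have pn' : (p <= n)%N by lia.
have [rho /andP[rho0 rhoP]] := mi_countE_R n (ltnW p1).
have := sum_first_MI_R p1 pn'.
rewrite /average_first card_MI //.
set C := (mi_count p n)%:R; set S := \sum_(x in _) _.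
have : 2 <= p%:R :> R by rewrite ler_nat.
have : 2 * p%:R <= n%:R :> R by rewrite -natrM ler_nat.
move: rho0 rhoP; move: (p%:R : R) (n%:R : R) C S => P N C S r0 rP PN P2 eS eC.
have N0 : 0 < N by lra.
have N2 : 4 * P ^+ 2 <= N ^+ 2 by nra.
(* Since [n >= 2p], [rho] is at most [N^2 / 4]. This lower bound on the denominator is the source of
   the factor 2 in the constant. *)
have D2 : N ^+ 2 / 2 <= (P - 1) * N ^+ 2 - rho by nra.
have D0 : 0 < (P - 1) * N ^+ 2 - rho by nra.
have C0 : C != 0 by apply/eqP => C0; rewrite C0 mulr0 in eC; lra.
have -> : S = P * C - P * (P - 1) * (3 * N - (P + 1)) / 6 by lra.
have -> : C = ((P - 1) * N ^+ 2 - rho) / (2 * P) by rewrite -eC; field; lra.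
set D := (P - 1) * N ^+ 2 - rho in D2 D0 eC *.
have -> : (P * (D / (2 * P)) - P * (P - 1) * (3 * N - (P + 1)) / 6) /
    (D / (2 * P)) / P - (1 - P / N + P * (P + 1) / (3 * N ^+ 2)) =
    - (P * (N - (P + 1) / 3) * rho / (N ^+ 2 * D)).
  have DN : D != 0 by rewrite gt_eqF.
  rewrite (_ : rho = (P - 1) * N ^+ 2 - D); last by rewrite /D; ring.
  by field; rewrite DN; lra.
rewrite normrN ger0_norm; last first.
  by rewrite divr_ge0 ?mulr_ge0 //; nra.
rewrite ler_pdivrMr; last by rewrite mulr_gt0 // exprn_gt0.
have -> : 2 * P ^+ 3 * (N ^+ 3)^-1 * (N ^+ 2 * D) = P ^+ 3 * (2 * D / N).
  by field; lra.
have h : N <= 2 * D / N by rewrite ler_pdivlMr //; nra.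
have hN : (N - (P + 1) / 3) * rho <= N * P ^+ 2 by apply: ler_pM; lra.
have P3 : 0 <= P ^+ 3 by rewrite exprn_ge0 //; lra.
apply: le_trans (ler_wpM2l P3 h).
by rewrite -mulrA exprS -mulrA ler_pM2l 1?[P ^+ 2 * N]mulrC //; lra.
Qed.

End Asymptotics.

Theorem proposition3p4 (R : realType) (p : nat) (hp : (2 <= p)%N) :
  exists e : nat -> R,
    e =O_\oo (fun n : nat => (n%:R ^+ 3)^-1 : R) /\
    \forall n \near \oo,
      average_first R n p =
      p%:R * (1 - p%:R / n%:R + p%:R * (p%:R + 1) / (3%:R * n%:R ^+ 2) + e n).
Proof.
have p0 : p%:R != 0 :> R by rewrite pnatr_eq0; lia.
(* Taking the exact relative error makes the identity hold for every [n]; only the bound needs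
   [n >= 2p]. *)
exists (fun n => average_first R n p / p%:R
  - (1 - p%:R / n%:R + p%:R * (p%:R + 1) / (3%:R * n%:R ^+ 2))); split.
  apply/eqO_exP; exists (2 * p%:R ^+ 3).
    by rewrite mulr_gt0 // exprn_gt0 // ltr0n; lia.
  exists (2 * p)%N => // n /= pn.
  rewrite [X in _ <= _ * X]ger0_norm ?invr_ge0 ?exprn_ge0 //.
  exact: average_first_bound.
by apply: nearW => n; rewrite subrKC mulrC divfK.
Qed.
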